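(* Let $G=(V,E)$ be a finite graph with symmetric positive edge weights $\omega_{xy}$ and measure $\mu:V\to(0,\infty)$. Let $m_1,m_2\ge 1$ be integers, $p,q>1$ real, $h_1,h_2:V\to\mathbb{R}$ and $F:V\times\mathbb{R}^2\to\mathbb{R}$. Write $|V|=\sum_{x\in V}\mu(x)$, $h_{i,\min}=\min_{x\in V}h_i(x)$ $(i=1,2)$, $\mu_{\min}=\min_{x\in V}\mu(x)$, and $$\kappa_1=\Big(\frac1p\int_V h_1\,d\mu\Big)^{-1/p},\qquad \kappa_2=\Big(\frac1q\int_V h_2\,d\mu\Big)^{-1/q}.$$ Assume: (H) $h_i(x)>0$ for all $x\in V$, $i=1,2$; (F0) for every $x\in V$, $F(x,s,t)$ is continuously differentiable in $(s,t)\in\mathbb{R}^2$; (F1) $\int_V F(x,0,0)\,d\mu=0$; (F2) there exist constants $\alpha\in[0,p)$, $\beta\in[0,q)$ and functions $f_1,f_2,g:V\to\mathbb{R}$ such that $F(x,s,t)\le f_1(x)|s|^\alpha+f_2(x)|t|^\beta+g(x)$ for all $(x,s,t)\in V\times\mathbb{R}\times\mathbb{R}$; (F3) there are positive constants $\gamma_1,\gamma_2,\delta_1,\delta_2$ with $\delta_i>\gamma_i\kappa_i$, $i=1,2$, such that $\Lambda_1<\Lambda_2$, where $$\Lambda_1:=\frac{1}{\gamma_1^p+\gamma_2^q}\ \max_{x\in V,\ |s|\le \frac{(p\gamma_1^p+p\gamma_2^q)^{1/p}}{h_{1,\min}^{1/p}\mu_{\min}^{1/p}},\ |t|\le\frac{(q\gamma_1^p+q\gamma_2^q)^{1/q}}{h_{2,\min}^{1/q}\mu_{\min}^{1/q}}}F(x,s,t)\,|V|,$$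 $$\Lambda_2:=\frac{\inf_{x\in V}F(x,\delta_1,\delta_2)\,|V|}{\frac{\delta_1^p}{p}\int_V h_1\,d\mu+\frac{\delta_2^q}{q}\int_V h_2\,d\mu}.$$ Then for each $\lambda\in(\Lambda_2^{-1},\Lambda_1^{-1})$ the system $$\begin{cases}\mathcal{L}_{m_1,p}u+h_1(x)|u|^{p-2}u=\lambda F_u(x,u,v), & x\in V,\\ \mathcal{L}_{m_2,q}v+h_2(x)|v|^{q-2}v=\lambda F_v(x,u,v), & x\in V,\end{cases}$$ has at least three distinct solutions $(u,v)$, $u,v:V\to\mathbb{R}$.
   Context: $G=(V,E)$ is a graph; each edge $xy\in E$ has a weight $\omega_{xy}=\omega_{yx}>0$; $y\sim x$ means $xy\in E$. $G$ is finite if $V$ and $E$ are finite. For $u:V\to\mathbb{R}$, $\int_V u\,d\mu=\sum_{x\in V}\mu(x)u(x)$. The Laplacian is $\Delta u(x)=\frac1{\mu(x)}\sum_{y\sim x}\omega_{xy}(u(y)-u(x))$; $\Delta^k$ is its $k$-th iterate, $\Delta^0u=u$. Put $\Gamma(u,v)(x)=\frac1{2\mu(x)}\sum_{y\sim x}\omega_{xy}(u(y)-u(x))(v(y)-v(x))$ and $|\nabla u|(x)=\sqrt{\Gamma(u,u)(x)}$. For an integer $m\ge1$, $|\nabla^m u|=|\nabla\Delta^{(m-1)/2}u|$ if $m$ is odd and $|\nabla^m u|=|\Delta^{m/2}u|$ if $m$ is even. For an integer $m\ge1$ and $l>1$, the operator $\mathcal{L}_{m,l}$ is defined by: for $u:V\to\mathbb{R}$,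 $\mathcal{L}_{m,l}u:V\to\mathbb{R}$ is the function such that for every $\phi:V\to\mathbb{R}$, $$\int_V(\mathcal{L}_{m,l}u)\phi\,d\mu=\begin{cases}\int_V|\nabla^m u|^{l-2}\,\Gamma(\Delta^{\frac{m-1}{2}}u,\Delta^{\frac{m-1}{2}}\phi)\,d\mu,& m\text{ odd},\\ \int_V|\nabla^m u|^{l-2}\,\Delta^{\frac m2}u\,\Delta^{\frac m2}\phi\,d\mu,& m\text{ even}.\end{cases}$$ When $l<2$, terms $|\nabla^m u|^{l-2}(\cdots)$ at vertices where $|\nabla^m u|=0$, and $|u|^{l-2}u$ where $u=0$, are understood to be $0$. $F_u,F_v$ denote the partial derivatives of $F(x,\cdot,\cdot)$ in its first and second real variables. *)

(* Defs.v *)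
From HB Require Import structures.
From mathcomp Require Import all_boot all_order all_algebra.
From mathcomp Require Import all_classical all_reals all_analysis.
Set Implicit Arguments.
Unset Strict Implicit.
Unset Printing Implicit Defensive.
Import Order.TTheory GRing.Theory Num.Theory.
Import numFieldNormedType.Exports.
Local Open Scope classical_set_scope.
Local Open Scope ring_scope.

(* Only the values of [weight] on edges matter. Loops are not excluded; they
   contribute 0 to both the Laplacian and the gradient form. *)
Record weighted_graph (R : realType) := WeightedGraph {
  vertex :> finType;
  adj : rel vertex;
  weight : vertex -> vertex -> R;
  vmeas : vertex -> R;
  adj_sym : forall x y, adj x y = adj y x;
  weight_sym : forall x y, adj x y -> weight x y = weight y x;
  weight_gt0 : forall x y, adj x y -> 0 < weight x y;
  vmeas_gt0 : forall x, 0 < vmeas x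
}.

Section GraphCalculus.
Context {R : realType} {G : weighted_graph R}.
Implicit Types (u v w phi h : G -> R) (m : nat) (l : R).

Definition vint u : R := \sum_(x : G) vmeas x * u x.

Definition laplacian u : G -> R := fun x =>
  (vmeas x)^-1 * \sum_(y | adj x y) weight x y * (u y - u x).

Definition laplacian_iter (k : nat) u : G -> R := iter k laplacian u.

Definition Gamma u v : G -> R := fun x =>
  (2 * vmeas x)^-1 *
    \sum_(y | adj x y) weight x y * (u y - u x) * (v y - v x).

Definition grad_norm u : G -> R := fun x => Num.sqrt (Gamma u u x).

(* Both halves are exact: [m.-1./2 = (m - 1) / 2] for odd [m] and
   [m./2 = m / 2] for even [m]. *)
Definition mgrad_norm m u : G -> R := fun x =>
  if odd m then grad_norm (laplacian_iter m.-1./2 u) x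
  else `|laplacian_iter m./2 u x|.

(* Since [0 `^ a = 0] for every [a != 0], the terms at the vertices where the
   base [mgrad_norm m u x] vanishes are 0, also when [l < 2]. *)
Definition weak_form m l u phi : R :=
  if odd m then
    vint (fun x => mgrad_norm m u x `^ (l - 2) *
      Gamma (laplacian_iter m.-1./2 u) (laplacian_iter m.-1./2 phi) x)
  else
    vint (fun x => mgrad_norm m u x `^ (l - 2) *
      laplacian_iter m./2 u x * laplacian_iter m./2 phi x).

(* The function w with \int w phi = weak_form m l u phi for all phi. It exists
   because [weak_form m l u] is linear and V is finite, and it is unique
   because [vmeas] is positive; the default value of [xget] is never used. *)
Definition Lop m l u : G -> R :=
  xget (fun=> 0) [set w : G -> R |
    forall phi, vint (fun x => w x * phi x) = weak_form m l u phi].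

Definition vol : R := \sum_(x : G) vmeas x.

Definition kappa l h : R := (l^-1 * vint h) `^ (- l^-1).

End GraphCalculus.

Arguments vol {R} G.

Definition partial1 {R : realType} (f : R -> R -> R) (s t : R) : R :=
  derive1 (fun s' => f s' t) s.

Definition partial2 {R : realType} (f : R -> R -> R) (s t : R) : R :=
  derive1 (fun t' => f s t') t.

Definition cont_diff2 {R : realType} (f : R -> R -> R) : Prop :=
  [/\ forall s t, derivable (fun s' => f s' t) s 1,
      forall s t, derivable (fun t' => f s t') t 1,
      continuous (fun z : R * R => partial1 f z.1 z.2) &
      continuous (fun z : R * R => partial2 f z.1 z.2)].

Section System.
Context {R : realType} {G : weighted_graph R}.
Variables (p q : R) (h1 h2 : G -> R) (F : G -> R -> R -> R).
Variables (gamma1 gamma2 delta1 delta2 : R).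

(* [range h] is finite, so this [inf] is a minimum. *)
Definition vmin (h : G -> R) : R := inf (range h).

Definition radius1 : R :=
  (p * gamma1 `^ p + p * gamma2 `^ q) `^ p^-1 /
  (vmin h1 `^ p^-1 * vmin (@vmeas R G) `^ p^-1).

Definition radius2 : R :=
  (q * gamma1 `^ p + q * gamma2 `^ q) `^ q^-1 /
  (vmin h2 `^ q^-1 * vmin (@vmeas R G) `^ q^-1).

(* When every [F x] is continuous this [sup] is a maximum: V is finite and
   (s, t) ranges over a compact rectangle. *)
Definition Lambda1 : R :=
  (gamma1 `^ p + gamma2 `^ q)^-1 *
  sup [set r | exists (x : G) (s t : R),
         [/\ `|s| <= radius1, `|t| <= radius2 & r = F x s t]] *
  vol G.

Definition Lambda2 : R :=
  vmin (fun x => F x delta1 delta2) * vol G /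
  (delta1 `^ p / p * vint h1 + delta2 `^ q / q * vint h2).

Definition system_solution (m1 m2 : nat) (lambda : R)
    (z : (G -> R) * (G -> R)) : Prop :=
  let: (u, v) := z in
  forall x : G,
    Lop m1 p u x + h1 x * (`|u x| `^ (p - 2) * u x)
      = lambda * partial1 (F x) (u x) (v x) /\
    Lop m2 q v x + h2 x * (`|v x| `^ (q - 2) * v x)
      = lambda * partial2 (F x) (u x) (v x).

End System.

(* Main.v *)
Require Import Defs.
From HB Require Import structures.
From mathcomp Require Import all_boot all_order all_algebra.
From mathcomp Require Import all_classical all_reals all_analysis.
From mathcomp Require Import ring lra.
Import Order.TTheory GRing.Theory Num.Theory.
Import numFieldNormedType.Exports.
Local Open Scope classical_set_scope.
Local Open Scope ring_scope.

(** The system is the Euler-Lagrange equation of [J = Phi - lambda Psi], where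
[Psi (u, v)] is the integral of [F (x, u, v)] and
[Phi (u, v) = 1/p (|nabla^m1 u|^p + h1 |u|^p) + 1/q (|nabla^m2 v|^q + h2 |v|^q)],
integrated. Put [r = gamma1^p + gamma2^q].

On [Phi = r] the values of [u] and [v] lie in the rectangle over which [Lambda1]
takes its supremum ([energy_radius]), so [Psi <= r Lambda1] and
[J >= rho := r (1 - lambda Lambda1) > 0]. On the other hand [J 0 = 0] inside
[Phi < r]; and the constant pair [w = (delta1, delta2)], which lies in [Phi > r]
because [delta_i > gamma_i kappa_i], satisfies
[Psi w >= Lambda2 (Phi w) > (Phi w) / lambda], so [J w < 0]. The growth bound on
[F] makes the sublevel sets of [J] compact ([action_compact]). Hence [J] attains
its minimum over [Phi <= r] and over [Phi >= r] at points with [J <= 0]. These lie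
off [Phi = r], so they are two distinct local minima, thus critical. A third
critical point, at a level at least [rho], is a mountain pass between them.

The mountain pass needs no gradient flow. Let [c] be the infimum over the
connected sets [K] containing both minima of the supremum of [J] on [K], and let
[eta t z = z - t (grad J z)] be one step of gradient descent. It is continuous and
fixes critical points, so [eta t] maps a competitor [K] to a competitor; without
critical points at the level [c], compactness shows that a single small step
brings a nearly optimal [K] strictly below [c] ([minimax_critical_point]).

For the gradient, weighted by the measure, one takes the residual of the system,
so that critical points are solutions by construction. What has to be shown is
that a step decreases [J] at the expected rate, uniformly near any non-critical
point ([step_descent]). The convex part [Phi] is bounded by its gradient
inequality ([energy_subgradient]), a consequence of the Cauchy-Schwarz and Young
inequalities, so that no power of a seminorm is ever differentiated; [Psi] is
handled by the mean value theorem in each of the two real variables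
([cont_diff2_quotient]). *)

(** * Three critical points from a descent step *)

(** [eta t] stands for a step of length [t] against the gradient of [J]. The rate
of decrease [e] holds on a neighbourhood of [z] for all small [t] at once; this is
what lets a compactness argument replace a deformation along a flow. *)
Section CriticalPoints.
Context {R : realType} {T : topologicalType}.
Variables (J : T -> R) (crit : set T) (eta : R -> T -> T).
Hypothesis J_cont : continuous J.
Hypothesis J_compact : forall s, compact [set z | J z <= s].
Hypothesis eta_crit : forall t z, crit z -> eta t z = z.
Hypothesis eta_cont : forall t, continuous (eta t).
Hypothesis eta_near : forall z : T,
  (fun yt : T * R => eta yt.2 yt.1) @ filter_prod (nbhs z) 0^'+ --> z.
Hypothesis eta_descent : forall z, ~ crit z -> exists2 e : R, 0 < e &
  \forall y \near z & t \near 0^'+, J (eta t y) <= J y - t * e.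

Lemma local_min_critical (U : set T) z :
  open U -> U z -> (forall y, U y -> J z <= J y) -> crit z.
Proof.
move=> oU Uz zmin; apply: contrapT => /eta_descent[e e0 [[A B] /= [Az B0] AB]].
have [[C D] /= [Cz D0] CD] : filter_prod (nbhs z) 0^'+
    [set yt : T * R | U (eta yt.2 yt.1)].
  by apply: eta_near; exact: open_nbhs_nbhs.
have := @filter_ex _ (0 : R)^'+ _ (B `&` D `&` [set t | 0 < t]).
case; first by apply: filterI; [exact: filterI | exact: nbhs_right_gt].
move=> t [[Bt Dt] /= t0].
have := AB (z, t) (conj (nbhs_singleton Az) Bt) => /=.
have := zmin _ (CD (z, t) (conj (nbhs_singleton Cz) Dt)) => /= h1 h2.
have := le_trans h1 h2; have := mulr_gt0 t0 e0; lra.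
Qed.

(** The level of the critical point is the minimax value [c]. If no point at the
level [c] were critical, then every point of the compact set [J <= c + 1] would
have a neighbourhood on which, for small [t], the step sends [J <= c + t^2] into
[J <= c - t^2]: near the level [c] the descent gains [t * e], which exceeds
[2 t^2], and below [c] the step moves little. By compactness one [t] serves for
the whole set. The image of a connected set that is optimal up to [t^2] then has
[J <= c - t^2], and still joins [a] to [b], which the step fixes. *)
Lemma minimax_critical_point (a b : T) (rho : R) :
  crit a -> crit b ->
  (exists K, [/\ connected K, K a, K b & exists s, forall z, K z -> J z <= s]) ->
  (forall K, connected K -> K a -> K b -> exists2 z, K z & rho <= J z) ->
  exists2 z, crit z & rho <= J z.
Proof.
move=> ca cb [K0 [K0c K0a K0b [s0 K0s]]] sep.
pose A := [set s | exists K,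
  [/\ connected K, K a, K b & forall z, K z -> J z <= s]].
have A_rho : lbound A rho.
  move=> s [K [Kc Ka Kb Ks]]; have [z Kz rz] := sep K Kc Ka Kb.
  exact: le_trans rz (Ks z Kz).
have infA : has_inf A by split; [exists s0, K0 | exists rho].
pose c := inf A.
have rho_c : rho <= c by apply: lb_le_inf => //; case: infA.
apply: contrapT => nocrit.
have := J_compact (c + 1) => /compact_near_coveringP.
move=> /(_ R 0^'+ (fun t y => J y <= c + t ^+ 2 -> J (eta t y) <= c - t ^+ 2)).
case.
  move=> z /= _.
  have sq_small (e : R) : 0 < e -> \forall t \near (0 : R)^'+, t ^+ 2 < e.
    move=> e0; near=> t; have t0 : 0 < t by near: t; exact: nbhs_right_gt.
    have te : t < e by near: t; exact: nbhs_right_lt.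
    have t1 : t < 1 by near: t; exact: nbhs_right_lt.
    by rewrite expr2; nra.
  have [zc|zc|zc] := ltgtP (J z) c.
  - pose e := (c - J z) / 2.
    have e0 : 0 < e by rewrite /e; lra.
    have near_lt : filter_prod (nbhs z) 0^'+
        [set yt : T * R | J (eta yt.2 yt.1) < c - e].
      have zce : J z < c - e by rewrite /e; lra.
      exact: (cvg_comp _ _ (eta_near z) (J_cont z) _ (lt_nbhsl zce)).
    have near_t : \forall y \near z & t \near (0 : R)^'+, t ^+ 2 < e.
      exists (setT, [set t : R | t ^+ 2 < e]); last by move=> [y t] [_ /=].
      by split => //=; [exact: filterT | exact: sq_small].
    apply: filterS2 near_lt near_t => -[y t] /= h1 h2 _; lra.
  - pose e := (J z - c) / 2.
    have e0 : 0 < e by rewrite /e; lra.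
    exists ([set y | c + e < J y], [set t : R | t ^+ 2 < e]).
      split => /=; last exact: sq_small.
      have zce : c + e < J z by rewrite /e; lra.
      exact: (J_cont z _ (lt_nbhsr zce)).
    by move=> [y t] /= [h1 h2] h3; lra.
  - have ncz : ~ crit z by move=> cz; apply: nocrit; exists z => //; rewrite zc.
    have [e e0 de] := eta_descent _ ncz.
    have near_t : \forall y \near z & t \near (0 : R)^'+, 0 < t < e / 2.
      exists (setT, [set t : R | 0 < t < e / 2]); last by move=> [y t] [_ /=].
      split => /=; first exact: filterT.
      near=> t; apply/andP; split; near: t; first exact: nbhs_right_gt.
      by apply: nbhs_right_lt; lra.
    apply: filterS2 de near_t => -[y t] /= h1 /andP[t0 te] h2.
    by apply: (le_trans h1); rewrite expr2 in h2 *; nra.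
move=> e /= e0 cover.
pose t := Num.min (e / 2) 1.
have t0 : 0 < t by rewrite /t lt_min; apply/andP; split; lra.
have te : t < e by rewrite /t gt_min; apply/orP; left; lra.
have t1 : t <= 1 by rewrite /t ge_min lexx orbT.
have tt : 0 < t ^+ 2 by rewrite exprn_gt0.
have tt1 : t ^+ 2 <= 1 by rewrite expr2; nra.
have [s [K [Kc Ka Kb Ks]] sc] := inf_adherent tt infA.
have {}cover := cover t; rewrite /ball /= sub0r normrN gtr0_norm// in cover.
have {}cover := cover te t0.
have : A (c - t ^+ 2).
  exists (eta t @` K); split.
  - by apply: connected_continuous_connected => //; exact: continuous_subspaceT.
  - by exists a => //; exact: eta_crit.
  - by exists b => //; exact: eta_crit.
  - move=> _ [z Kz <-]; have Jz : J z <= c + t ^+ 2.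
      by apply: le_trans (Ks z Kz) _; exact: ltW.
    by apply: cover => //=; lra.
move=> /(ge_inf infA.2); rewrite -/c; lra.
Unshelve. all: by end_near. Qed.

(** Two of the points minimize [J] on either side of the barrier [Phi = r], the
third is the minimax point between them. A connected set joining the two sides
meets the barrier by the intermediate value property of [Phi]. *)
Lemma three_critical_points (Phi : T -> R) (r rho : R) (a w : T) :
  continuous Phi -> 0 < rho ->
  (forall a b : T, exists g : R -> T, [/\ continuous g, g 0 = a & g 1 = b]) ->
  (forall z, Phi z = r -> rho <= J z) ->
  Phi a < r -> J a <= 0 -> r < Phi w -> J w <= 0 ->
  exists z1 z2 z3, [/\ crit z1, crit z2 & crit z3] /\
    [/\ z1 <> z2, z1 <> z3 & z2 <> z3].
Proof.
move=> Phi_cont rho0 path sep ar Ja wr Jw.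
(* A minimizer over the closed side [C] has [J <= 0], hence lies in its
   interior [U], where it is a local minimum. *)
have min_on (U C : set T) x : open U -> closed C -> U `<=` C ->
    (forall z, C z -> J z <= 0 -> U z) -> U x -> J x <= 0 ->
    exists z, [/\ crit z, U z & J z <= 0].
  move=> oU cC UC CU Ux Jx.
  have cK : compact ([set z | J z <= 0] `&` C) by exact: compact_closedI.
  have K0 : [set z | J z <= 0] `&` C !=set0 by exists x; split => //; exact: UC.
  have [z zK zmin] := compact_EVT_min K0 cK (continuous_subspaceT J_cont).
  move: zK; rewrite inE => -[/= Jz Cz]; exists z; split => //; last exact: CU.
  apply: (local_min_critical U) => //; first exact: CU.
  move=> y Uy; have [Jy|/ltW Jy] := leP (J y) 0; last exact: le_trans Jz Jy.
  by apply: zmin; rewrite inE; split => //; exact: UC.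
have off z : J z <= 0 -> Phi z <> r by move=> Jz /sep; lra.
have [z1 [c1 z1r J1]] : exists z, [/\ crit z, Phi z < r & J z <= 0].
  apply: (min_on [set z | Phi z < r] [set z | Phi z <= r] a) => //.
  - exact: (@open_comp _ _ Phi _ (in1W Phi_cont) (@open_lt R r)).
  - exact: (@preimage_closed _ _ Phi _ (in1W Phi_cont) (@closed_le R r)).
  - by move=> z /= /ltW.
  - by move=> z /= Cz Jz; rewrite lt_neqAle Cz andbT; apply/eqP; exact: off.
have [z2 [c2 z2r J2]] : exists z, [/\ crit z, r < Phi z & J z <= 0].
  apply: (min_on [set z | r < Phi z] [set z | r <= Phi z] w) => //.
  - exact: (@open_comp _ _ Phi _ (in1W Phi_cont) (@open_gt R r)).
  - exact: (@preimage_closed _ _ Phi _ (in1W Phi_cont) (@closed_ge R r)).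
  - by move=> z /= /ltW.
  - move=> z /= Cz Jz; rewrite lt_neqAle Cz andbT eq_sym.
    by apply/eqP; exact: off.
have [z3 c3 J3] : exists2 z, crit z & rho <= J z.
  apply: (minimax_critical_point z1 z2) => //.
  - have [g [gc g0 g1]] := path z1 z2.
    exists (g @` `[0, 1]); split.
    + apply: connected_continuous_connected; first exact: segment_connected.
      exact: continuous_subspaceT.
    + by exists 0 => //=; rewrite in_itv /= lexx ler01.
    + by exists 1 => //=; rewrite in_itv /= lexx ler01.
    + have cJg : {within `[0, 1], continuous (J \o g)}.
        apply: continuous_subspaceT => t; apply: continuous_comp; first exact: gc.
        exact: J_cont.
      have [t _ tmax] := EVT_max (@ler01 R) cJg.
      by exists (J (g t)) => _ [s s01 <-]; exact: tmax.
  - move=> K Kc K1 K2.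
    have /connected_intervalP KI : connected (Phi @` K).
      by apply: connected_continuous_connected => //; exact: continuous_subspaceT.
    have [z Kz zr] : (Phi @` K) r.
      by apply: (KI (Phi z1) (Phi z2)); [exists z1|exists z2|lra].
    by exists z => //; exact: sep.
exists z1, z2, z3; split => //; split.
- by move=> z12; move: z1r z2r; rewrite z12; lra.
- by move=> z13; move: J1 J3; rewrite z13; lra.
- by move=> z23; move: J2 J3; rewrite z23; lra.
Qed.

End CriticalPoints.

(** * Convergence along a filter *)

Section PointwiseConvergence.
Context {R : realType}.

Lemma cvg_ptws {I : choiceType} {X : Type} (F : set_system X) {FF : Filter F}
    (f : X -> {ptws I -> R}) (z : {ptws I -> R}) :
  (forall i, f x i @[x --> F] --> z i) -> f @ F --> z.
Proof.
move=> fz; apply/cvg_sup => i; apply/cvg_image.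
  rewrite eqEsubset; split => [//|c _].
  by exists (dfwith z i c) => //; rewrite dfwithin.
move=> B /(fz i) FB; exists [set g : {ptws I -> R} | B (g i)] => //.
rewrite eqEsubset; split => [_ [g Bg <-] //|c Bc].
by exists (dfwith z i c) => //=; rewrite dfwithin.
Qed.

Lemma ptws_coord_cvg {I : choiceType} {X : Type} (F : set_system X)
    {FF : Filter F} (f : X -> {ptws I -> R}) (z : {ptws I -> R}) i :
  f @ F --> z -> f x i @[x --> F] --> z i.
Proof. by move=> fz; exact: (cvg_comp _ _ fz (@proj_continuous _ _ i z)). Qed.

Lemma ptws_path (I : choiceType) (a b : {ptws I -> R}) :
  exists g : R -> {ptws I -> R}, [/\ continuous g, g 0 = a & g 1 = b].
Proof.
exists (fun t i => a i + t * (b i - a i)); split.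
- move=> t; apply: cvg_ptws => i; apply: cvgD; first exact: cvg_cst.
  by apply: cvgM; [exact: cvg_id | exact: cvg_cst].
- by apply/funext => i; rewrite mul0r addr0.
- by apply/funext => i; rewrite mul1r addrC subrK.
Qed.

End PointwiseConvergence.

Section RealConvergence.
Context {R : realType} {X : Type} (F : set_system X) {FF : Filter F}.

Lemma cvg0_dominated (f h : X -> R) : (forall x, `|f x| <= h x) ->
  h @ F --> (0 : R) -> f @ F --> (0 : R).
Proof.
move=> fh /cvgrPdist_lt h0; apply/cvgrPdist_lt => e e0.
apply: filterS (h0 e e0) => x; rewrite !sub0r !normrN => hx.
by apply: le_lt_trans (fh x) _; apply: le_lt_trans (ler_norm _) hx.
Qed.

Lemma cvg_fsum (I : Type) (s : seq I) (P : pred I) (f : I -> X -> R)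
    (a : I -> R) :
  (forall i, P i -> f i x @[x --> F] --> a i) ->
  \sum_(i <- s | P i) f i x @[x --> F] --> \sum_(i <- s | P i) a i.
Proof. by move=> fa; apply: cvg_big => //; exact: add_continuous. Qed.

Lemma cvg_powR_pos (f : X -> R) (a r : R) :
  0 < a -> f @ F --> a -> f x `^ r @[x --> F] --> a `^ r.
Proof.
move=> a0 fa; apply: (@cvg_comp _ _ _ f (fun y => y `^ r) _ _ _ fa).
suff /differentiable_continuous : differentiable (fun x : R => x `^ r) a by [].
by apply/derivable1_diffP; apply: derivable_powR; rewrite in_itv /= andbT.
Qed.

Lemma cvg_powR (f : X -> R) (a r : R) : 0 < r -> (forall x, 0 <= f x) ->
  0 <= a -> f @ F --> a -> f x `^ r @[x --> F] --> a `^ r.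
Proof.
move=> r0 f0; rewrite le_eqVlt => /predU1P[<-|]; last exact: cvg_powR_pos.
rewrite (powR0 (lt0r_neq0 r0)) => fa; apply/cvgrPdist_lt => e e0.
have d0 : 0 < e `^ r^-1 by rewrite powR_gt0.
move/cvgrPdist_lt: fa => /(_ _ d0); apply: filterS => x.
rewrite !sub0r !normrN ger0_norm// ger0_norm ?powR_ge0// => fx.
have := gt0_ltr_powR r0 (f0 x) (powR_ge0 _ _) fx.
by rewrite -powRrM mulVf ?lt0r_neq0// powRr1 // ltW.
Qed.

(** For [1 < l] the map sending a vector of length [N] with a component [L] to
[N^(l-2) L] is continuous even at [0], although its first factor blows up there
when [l < 2]: the product is of size [N^(l-1)]. *)
Lemma cvg_duality (N L : X -> R) (N0 L0 C l : R) : 1 < l ->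
  (forall x, 0 <= N x) -> 0 <= N0 ->
  (forall x, `|L x| <= C * N x) -> `|L0| <= C * N0 ->
  N @ F --> N0 -> L @ F --> L0 ->
  N x `^ (l - 2) * L x @[x --> F] --> N0 `^ (l - 2) * L0.
Proof.
move=> l1 N_ge0; rewrite le_eqVlt => /predU1P[<-|N0_gt0] LN; last first.
  by move=> _ NN LL; apply: cvgM => //; exact: cvg_powR_pos.
rewrite mulr0 normr_le0 => /eqP -> NN LL; rewrite mulr0.
apply: (@cvg0_dominated _ (fun x => C * N x `^ (l - 1))).
- move=> x; rewrite normrM (ger0_norm (powR_ge0 _ _)).
  rewrite -(mulr_powRB1 (N_ge0 x) (_ : 0 < l - 1)) ?subr_gt0//.
  rewrite (_ : l - 1 - 1 = l - 2); last lra.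
  by rewrite mulrA [leRHS]mulrC; apply: ler_wpM2l => //; exact: powR_ge0.
- rewrite -[X in _ --> X](mulr0 C); apply: cvgM; first exact: cvg_cst.
  rewrite -(@powR0 _ (l - 1)); last by rewrite subr_eq0 gt_eqF.
  by apply: cvg_powR => //; rewrite subr_gt0.
Qed.

End RealConvergence.

(** * Functions with continuous partial derivatives *)

Section ContDiff.
Context {R : realType}.

Lemma mean_value (f : R -> R) (a b : R) : (forall x : R, derivable f x 1) ->
  exists2 c, `|c - a| <= `|b - a| & f b - f a = derive1 f c * (b - a).
Proof.
move=> df.
have is_df (x : R) : is_derive x 1 f (derive1 f x).
  by rewrite derive1E; exact: derivableP.
have cf (x y : R) : {within `[x, y], continuous f}.
  apply: continuous_subspaceT => z; apply: differentiable_continuous.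
  exact/derivable1_diffP.
have [ab|/ltW ba] := leP a b.
  have [c] := MVT_segment ab (fun x _ => is_df x) (cf _ _).
  rewrite in_itv /= => /andP[ac cb] E; exists c => //.
  by rewrite !ger0_norm ?subr_ge0//; lra.
have [c] := MVT_segment ba (fun x _ => is_df x) (cf _ _).
rewrite in_itv /= => /andP[bc ca] E; exists c; last by lra.
by rewrite !ler0_norm ?subr_le0//; lra.
Qed.

(** The two partial derivatives are taken at different points: the increment is
split at the corner [(s, t')], and each half uses the mean value theorem in one
variable. *)
Lemma mean_value2 (f : R -> R -> R) (s t s' t' : R) : cont_diff2 f ->
  exists c : R * R, [/\ `|c.1 - s| <= `|s' - s|, `|c.2 - t| <= `|t' - t| &
    f s' t' - f s t =
      partial1 f c.1 t' * (s' - s) + partial2 f s c.2 * (t' - t)].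
Proof.
move=> [d1 d2 _ _].
have [c1 h1 e1] := mean_value (fun s => f s t') s s' (fun x => d1 x t').
have [c2 h2 e2] := mean_value (f s) t t' (d2 s).
by exists (c1, c2); split => //=; rewrite /partial1 /partial2 -e1 -e2; lra.
Qed.

Context {X : Type} (F : set_system X) {FF : Filter F}.

Lemma cvg_cont2 (g : R -> R -> R) (s t : X -> R) (s0 t0 : R) :
  continuous (fun z : R * R => g z.1 z.2) ->
  s @ F --> s0 -> t @ F --> t0 -> g (s x) (t x) @[x --> F] --> g s0 t0.
Proof.
move=> gc ss tt.
exact: (cvg_comp (fun x => (s x, t x)) _ (cvg_pair ss tt) (gc (s0, t0))).
Qed.

Lemma cvg_between (s s' c : X -> R) (s0 : R) :
  s @ F --> s0 -> s' @ F --> s0 -> (forall x, `|c x - s x| <= `|s' x - s x|) ->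
  c @ F --> s0.
Proof.
move=> ss ss' cs.
rewrite (_ : c = fun x => s x + (c x - s x)); last by apply/funext => x; lra.
rewrite -[X in _ --> X](addr0 s0); apply: cvgD => //.
apply: cvg0_dominated cs _.
rewrite -(normr0 R) -(subrr s0); apply: cvg_norm; exact: cvgB.
Qed.

Lemma cont_diff2_cvg (f : R -> R -> R) (s t : X -> R) (s0 t0 : R) :
  cont_diff2 f -> s @ F --> s0 -> t @ F --> t0 ->
  f (s x) (t x) @[x --> F] --> f s0 t0.
Proof.
move=> fC ss tt; have [_ _ c1 c2] := fC.
have /choice[c cP] := fun x => mean_value2 f s0 t0 (s x) (t x) fC.
have cs : (c x).1 @[x --> F] --> s0.
  by apply: (cvg_between (fun=> s0) s) => // x; [exact: cvg_cst | case: (cP x)].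
have ct : (c x).2 @[x --> F] --> t0.
  by apply: (cvg_between (fun=> t0) t) => // x; [exact: cvg_cst | case: (cP x)].
rewrite (_ : (fun x => _) = fun x => f s0 t0 +
    (partial1 f (c x).1 (t x) * (s x - s0) + partial2 f s0 (c x).2 * (t x - t0))).
  rewrite -[X in _ --> X]addr0 -[X in _ + X]addr0; apply: cvgD; first exact: cvg_cst.
  apply: cvgD.
  - rewrite -[X in _ --> X](mulr0 (partial1 f s0 t0)) -(subrr s0).
    by apply: cvgM; [exact: cvg_cont2 | apply: cvgB => //; exact: cvg_cst].
  - rewrite -[X in _ --> X](mulr0 (partial2 f s0 t0)) -(subrr t0).
    apply: cvgM; last by apply: cvgB => //; exact: cvg_cst.
    by apply: cvg_cont2 => //; exact: cvg_cst.
by apply/funext => x; have [_ _ <-] := cP x; lra.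
Qed.

(** Strict differentiability: the base point and the direction may move while the
increment [tau] tends to zero. The limit along a single line would not give a rate
of descent that is uniform near a point. *)
Lemma cont_diff2_quotient (f : R -> R -> R) (s t a b tau : X -> R)
    (s0 t0 a0 b0 : R) : cont_diff2 f ->
  s @ F --> s0 -> t @ F --> t0 -> a @ F --> a0 -> b @ F --> b0 ->
  tau @ F --> (0 : R) -> (\forall x \near F, tau x != 0) ->
  (f (s x + tau x * a x) (t x + tau x * b x) - f (s x) (t x)) / tau x
    @[x --> F] --> partial1 f s0 t0 * a0 + partial2 f s0 t0 * b0.
Proof.
move=> fC ss tt aa bb tau0 tauN; have [_ _ c1 c2] := fC.
have shift (u c : X -> R) (u0 c0 : R) : u @ F --> u0 -> c @ F --> c0 ->
    u x + tau x * c x @[x --> F] --> u0.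
  move=> uu cc; rewrite -[X in _ --> X]addr0; apply: cvgD => //.
  by rewrite -[X in _ --> X](mul0r c0); exact: cvgM.
have /choice[c cP] := fun x => mean_value2 f (s x) (t x)
  (s x + tau x * a x) (t x + tau x * b x) fC.
have cs : (c x).1 @[x --> F] --> s0.
  by apply: (cvg_between s (fun x => s x + tau x * a x));
    [|exact: (shift _ _ _ a0)|move=> x; case: (cP x)].
have ct : (c x).2 @[x --> F] --> t0.
  by apply: (cvg_between t (fun x => t x + tau x * b x));
    [|exact: (shift _ _ _ b0)|move=> x; case: (cP x)].
apply: (@cvg_trans _ ((partial1 f (c x).1 (t x + tau x * b x) * a x +
    partial2 f (s x) (c x).2 * b x) @[x --> F])).
  apply: near_eq_cvg; apply: filterS tauN => x taux.
  have [_ _ ->] := cP x; rewrite !(addrC _ (tau x * _)) !addrK.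
  by field.
apply: cvgD; apply: cvgM => //; apply: cvg_cont2 => //.
exact: (shift _ _ _ b0).
Qed.

End ContDiff.

(** * Energies on a weighted graph and their gradients *)

Section Energy.
Context {R : realType} {G : weighted_graph R}.
Implicit Types (u v w phi h : G -> R) (m : nat) (l : R).

Lemma vintD u v : vint (fun x => u x + v x) = vint u + vint v.
Proof. by rewrite /vint -big_split; apply: eq_bigr => x _; rewrite mulrDr. Qed.

Lemma vintZ c u : vint (fun x => c * u x) = c * vint u.
Proof. by rewrite /vint big_distrr; apply: eq_bigr => x _ /=; rewrite mulrCA. Qed.

Lemma vint_le u v : (forall x, u x <= v x) -> vint u <= vint v.
Proof.
move=> uv; apply: ler_sum => x _; apply: ler_wpM2l => //.
exact/ltW/vmeas_gt0.
Qed.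

Lemma vint_ge0 u : (forall x, 0 <= u x) -> 0 <= vint u.
Proof.
by move=> u0; apply: sumr_ge0 => x _; rewrite mulr_ge0// ltW// vmeas_gt0.
Qed.

Lemma vint_eq0 u : (forall x, 0 <= u x) -> vint u = 0 -> forall x, u x = 0.
Proof.
move=> u0 /eqP; rewrite psumr_eq0; last first.
  by move=> x _; rewrite mulr_ge0// ltW// vmeas_gt0.
move=> /allP h x; have := h x (mem_index_enum x).
by rewrite /= mulf_eq0 gt_eqF ?vmeas_gt0//= => /eqP.
Qed.

Lemma vint_ge_term u x : (forall y, 0 <= u y) -> vmeas x * u x <= vint u.
Proof.
move=> u0; rewrite /vint (bigD1 x) //= lerDl; apply: sumr_ge0 => y _.
by rewrite mulr_ge0// ltW// vmeas_gt0.
Qed.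

Definition delta (x y : G) : R := (y == x)%:R.

Lemma vint_delta u x : vint (fun y => u y * delta x y) = vmeas x * u x.
Proof.
rewrite /vint (bigD1 x) //= big1 ?addr0 /delta ?eqxx ?mulr1// => y /negbTE ->.
by rewrite !mulr0.
Qed.

(** Riesz representation on a finite set, with respect to the counting measure. *)
Lemma linear_delta (L : (G -> R) -> R) phi :
  (forall a u v, L (fun y => a * u y + v y) = a * L u + L v) ->
  L phi = \sum_(x : G) phi x * L (delta x).
Proof.
move=> Llin.
have L0 : L (fun=> 0) = 0.
  have := Llin 1 (fun=> 0) (fun=> 0).
  rewrite (_ : (fun y => _) = fun=> 0); first by lra.
  by apply/funext => y; rewrite mulr0 addr0.
have Lsum (s : seq G) : L (fun y => \sum_(x <- s) phi x * delta x y) =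
    \sum_(x <- s) phi x * L (delta x).
  elim: s => [|x s IH].
    by rewrite big_nil -[RHS]L0; congr L; apply/funext => y; rewrite big_nil.
  rewrite big_cons -IH -Llin; congr L.
  by apply/funext => y; rewrite big_cons.
rewrite -Lsum; congr L; apply/funext => y.
rewrite (bigD1 y) //= big1 ?addr0 /delta ?eqxx ?mulr1// => x /negbTE yx.
by rewrite eq_sym yx mulr0.
Qed.

Lemma laplacian_iter_lin k a u v :
  laplacian_iter k (fun y => a * u y + v y) =
  fun y => a * laplacian_iter k u y + laplacian_iter k v y.
Proof.
rewrite /laplacian_iter; elim: k => //= k ->; apply/funext => x.
rewrite /laplacian mulrCA -mulrDr; congr (_ * _).
by rewrite big_distrr -big_split; apply: eq_bigr => y _ /=; ring.
Qed.

Lemma laplacian_cst (c : R) : laplacian (fun _ : G => c) = fun=> 0.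
Proof.
apply/funext => x; rewrite /laplacian big1 ?mulr0// => y _.
by rewrite subrr mulr0.
Qed.

Lemma laplacian_iter_cst k (c : R) :
  laplacian_iter k (fun _ : G => c) = if k == 0%N then fun=> c else fun=> 0.
Proof.
rewrite /laplacian_iter; elim: k => //= k ->.
by case: (k == 0%N); rewrite laplacian_cst.
Qed.

(** The bilinear form whose quadratic form is the square of [mgrad_norm m]. It
treats the two parities of [m] at once. *)
Definition mform m u v : G -> R := fun x =>
  if odd m then Gamma (laplacian_iter m.-1./2 u) (laplacian_iter m.-1./2 v) x
  else laplacian_iter m./2 u x * laplacian_iter m./2 v x.

Lemma mformC m u v : mform m u v = mform m v u.
Proof.
apply/funext => x; rewrite /mform; case: ifP => _; last exact: mulrC.
by rewrite /Gamma; congr (_ * _); apply: eq_bigr => y _; ring.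
Qed.

Lemma mform_lin m a u v w x :
  mform m w (fun y => a * u y + v y) x = a * mform m w u x + mform m w v x.
Proof.
rewrite /mform !laplacian_iter_lin; case: ifP => _; last by ring.
rewrite /Gamma mulrCA -mulrDr; congr (_ * _).
by rewrite big_distrr -big_split; apply: eq_bigr => y _ /=; ring.
Qed.

Lemma mform_ge0 m u x : 0 <= mform m u u x.
Proof.
rewrite /mform; case: ifP => _; last by rewrite -expr2 sqr_ge0.
rewrite /Gamma mulr_ge0 ?invr_ge0 ?mulr_ge0 ?(ltW (vmeas_gt0 _))//.
apply: sumr_ge0 => y xy; rewrite -mulrA mulr_ge0 ?(ltW (weight_gt0 xy))//.
by rewrite -expr2 sqr_ge0.
Qed.

Lemma mform_CauchySchwarz m u v x :
  `|mform m u v x| <= Num.sqrt (mform m v v x) * Num.sqrt (mform m u u x).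
Proof.
rewrite -sqrtrM ?mform_ge0// -sqrtr_sqr; apply: ler_wsqrtr.
set A := mform m u u x; set B := mform m u v x; set C := mform m v v x.
have Q t : 0 <= A + 2 * t * B + t ^+ 2 * C.
  have := mform_ge0 m (fun y => t * v y + u y) x.
  rewrite mform_lin 2![mform m (fun y => t * v y + u y) _]mformC !mform_lin.
  by rewrite -/A -/C [mform m v u]mformC -/B; lra.
have C0 : 0 <= C := mform_ge0 m v x.
have := C0; rewrite le_eqVlt => /predU1P[C_0|C_gt0].
  (* A linear function of [t] that is bounded below is constant. *)
  have [->|B0] := eqVneq B 0; first by rewrite -C_0 mul0r expr0n.
  have := Q (- (A + 1) / (2 * B)); rewrite -C_0 mulr0 addr0.
  by rewrite (_ : 2 * _ * B = - (A + 1)); [lra | field].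
have := Q (- B / C).
rewrite (_ : A + _ + _ = (C * A - B ^+ 2) / C); last by field; rewrite gt_eqF.
by rewrite pmulr_lge0 ?invr_gt0// subr_ge0.
Qed.

Lemma mgrad_normE m u x : mgrad_norm m u x = Num.sqrt (mform m u u x).
Proof.
by rewrite /mgrad_norm /mform; case: ifP => // _; rewrite -expr2 sqrtr_sqr.
Qed.

Lemma mgrad_norm_ge0 m u x : 0 <= mgrad_norm m u x.
Proof. by rewrite mgrad_normE sqrtr_ge0. Qed.

Lemma mgrad_norm_cst m (c : R) x : (1 <= m)%N ->
  mgrad_norm m (fun _ : G => c) x = 0.
Proof.
move=> m1; rewrite mgrad_normE /mform !laplacian_iter_cst.
case: ifP => [_|modd].
  rewrite /Gamma big1 ?mulr0 ?sqrtr0// => y _.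
  by case: ifP => _; rewrite subrr mulr0.
by case: m m1 modd => [|[|m]] // _ _; rewrite /= mul0r sqrtr0.
Qed.

Lemma weak_formE m l u phi : weak_form m l u phi =
  vint (fun x => mgrad_norm m u x `^ (l - 2) * mform m u phi x).
Proof.
rewrite /weak_form /mform; case: ifP => // _.
by congr vint; apply/funext => x; rewrite mulrA.
Qed.

Lemma weak_form_lin m l w a u v :
  weak_form m l w (fun y => a * u y + v y) =
  a * weak_form m l w u + weak_form m l w v.
Proof.
rewrite !weak_formE -vintZ -vintD; congr vint.
by apply/funext => x; rewrite mform_lin; ring.
Qed.

(** Linearity of the weak form in the test function guarantees that the choice in
[Lop] succeeds. *)
Lemma vint_Lop m l u phi :
  vint (fun x => Lop m l u x * phi x) = weak_form m l u phi.
Proof.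
rewrite /Lop; set P := (X in xget _ X).
suff /(xgetPex (fun=> 0)) : exists w, P w by [].
exists (fun x => (vmeas x)^-1 * weak_form m l u (delta x)) => psi.
rewrite [RHS](linear_delta (weak_form m l u)); last exact: weak_form_lin.
by apply: eq_bigr => x _; field; rewrite gt_eqF// vmeas_gt0.
Qed.

Lemma LopE m l u x : Lop m l u x = (vmeas x)^-1 * weak_form m l u (delta x).
Proof. by rewrite -vint_Lop vint_delta mulKf// gt_eqF// vmeas_gt0. Qed.

Definition energy m l h u : R :=
  l^-1 * vint (fun x => mgrad_norm m u x `^ l + h x * `|u x| `^ l).

(** The gradient of the energy in the inner product [vint (u * v)]. It is the
left-hand side of one equation of the system. *)
Definition energy_grad m l h u : G -> R := fun x =>
  Lop m l u x + h x * (`|u x| `^ (l - 2) * u x).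

(** Gradient inequality for the convex function [l^-1 |.|^l] of a vector: [A] and
[B] are the lengths of two vectors and [P] is their inner product. It is Young's
inequality for [A] and [B^(l-1)]. *)
Lemma powR_subgradient (A B P l : R) : 1 < l -> 0 <= A -> 0 <= B -> P <= A * B ->
  l^-1 * B `^ l + B `^ (l - 2) * (P - B ^+ 2) <= l^-1 * A `^ l.
Proof.
move=> l1 A0; have l0 : 0 < l by lra.
rewrite le_eqVlt => /predU1P[<-|B0] PAB.
  rewrite (powR0 (lt0r_neq0 l0)) mulr0 add0r expr0n subr0.
  apply: (@le_trans _ _ 0); last by rewrite mulr_ge0 ?invr_ge0 ?powR_ge0 ?ltW.
  by rewrite mulr_ge0_le0 ?powR_ge0//; lra.
have Bl1 : B `^ (l - 2) * B = B `^ (l - 1).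
  rewrite mulrC -(mulr_powRB1 (ltW B0) (_ : 0 < l - 1)); last lra.
  by congr (_ * B `^ _); lra.
have Bl : B `^ (l - 2) * B ^+ 2 = B `^ l.
  by rewrite expr2 mulrA Bl1 mulrC mulr_powRB1// ltW.
have conj0 : 0 < l / (l - 1) by rewrite divr_gt0; lra.
have inv1 : l^-1 + (l / (l - 1))^-1 = 1.
  by field; rewrite subr_eq0 !gt_eqF.
have := conjugate_powR A0 (powR_ge0 B (l - 1)) l0 conj0 inv1.
rewrite -powRrM (_ : (l - 1) * (l / (l - 1)) = l); last first.
  by field; rewrite subr_eq0 gt_eqF.
rewrite (_ : B `^ l / (l / (l - 1)) = B `^ l - l^-1 * B `^ l); last first.
  by field; rewrite subr_eq0 !gt_eqF.
rewrite [A `^ l / l]mulrC => young.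
have := ler_wpM2l (powR_ge0 B (l - 2)) PAB.
by rewrite mulrBr Bl [B `^ (l - 2) * (A * B)]mulrCA Bl1; lra.
Qed.

(** Convexity of the energy, obtained by applying the pointwise inequality to
[nabla^m u] at each vertex, with Cauchy-Schwarz, and to the values of [u]. *)
Lemma energy_subgradient m l h u w : 1 < l -> (forall x, 0 < h x) ->
  energy m l h w + vint (fun x => energy_grad m l h w x * (u x - w x))
    <= energy m l h u.
Proof.
move=> l1 h0.
rewrite (_ : vint _ = weak_form m l w (fun x => (-1) * w x + u x) +
    vint (fun x => h x * (`|w x| `^ (l - 2) * w x) * (u x - w x))); last first.
  rewrite -vint_Lop -vintD; congr vint; apply/funext => x.
  by rewrite /energy_grad; ring.
rewrite weak_formE /energy -!vintZ -!vintD; apply: vint_le => x.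
rewrite mform_lin !mulrDr addrACA; apply: lerD.
  have PAB : mform m w u x <= mgrad_norm m u x * mgrad_norm m w x.
    rewrite !mgrad_normE; apply: le_trans (ler_norm _) _.
    exact: mform_CauchySchwarz.
  have := powR_subgradient _ _ _ _ l1 (mgrad_norm_ge0 _ _ _)
    (mgrad_norm_ge0 _ _ _) PAB.
  rewrite (_ : mgrad_norm m w x ^+ 2 = mform m w w x); first by lra.
  by rewrite mgrad_normE sqr_sqrtr// mform_ge0.
have wu : w x * u x <= `|u x| * `|w x|.
  by apply: le_trans (ler_norm _) _; rewrite normrM mulrC.
have := powR_subgradient _ _ _ _ l1 (normr_ge0 _) (normr_ge0 _) wu.
rewrite real_normK ?num_real// => /(ler_wpM2l (ltW (h0 x))); lra.
Qed.

Lemma energy_cst m l h (c : R) : (1 <= m)%N -> 1 < l ->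
  energy m l h (fun=> c) = `|c| `^ l / l * vint h.
Proof.
move=> m1 l1; rewrite [_ / l]mulrC -mulrA -vintZ; congr (_ * vint _).
apply/funext => x; rewrite mgrad_norm_cst// powR0 ?add0r 1?mulrC//.
by rewrite gt_eqF//; lra.
Qed.

Lemma energy_ge m l h u : 1 < l ->
  l^-1 * vint (fun x => h x * `|u x| `^ l) <= energy m l h u.
Proof.
move=> l1; rewrite /energy ler_pM2l ?invr_gt0; last by lra.
by apply: vint_le => x; rewrite lerDr powR_ge0.
Qed.

Section Continuity.
Context {X : Type} (F : set_system X) {FF : Filter F}.

Lemma vint_cvg (V : X -> G -> R) v :
  (forall x, V i x @[i --> F] --> v x) -> vint (V i) @[i --> F] --> vint v.
Proof.
by move=> Vv; apply: cvg_fsum => x _; apply: cvgM => //; exact: cvg_cst.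
Qed.

Lemma laplacian_iter_cvg (U : X -> G -> R) u k x :
  (forall x, U i x @[i --> F] --> u x) ->
  laplacian_iter k (U i) x @[i --> F] --> laplacian_iter k u x.
Proof.
move=> Uu; rewrite /laplacian_iter; elim: k x => //= k IH x.
apply: cvgM; first exact: cvg_cst.
apply: cvg_fsum => y _; apply: cvgM; first exact: cvg_cst.
by apply: cvgB; exact: IH.
Qed.

Lemma mform_cvg m (U V : X -> G -> R) u v x :
  (forall x, U i x @[i --> F] --> u x) ->
  (forall x, V i x @[i --> F] --> v x) ->
  mform m (U i) (V i) x @[i --> F] --> mform m u v x.
Proof.
move=> Uu Vv; rewrite /mform; case: ifP => _; last first.
  by apply: cvgM; exact: laplacian_iter_cvg.
apply: cvgM; first exact: cvg_cst.
apply: cvg_fsum => y _; apply: cvgM; last by apply: cvgB; exact: laplacian_iter_cvg.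
apply: cvgM; first exact: cvg_cst.
by apply: cvgB; exact: laplacian_iter_cvg.
Qed.

Variables (U : X -> G -> R) (u : G -> R).
Hypothesis Uu : forall x, U i x @[i --> F] --> u x.

Lemma mgrad_norm_cvg m x :
  mgrad_norm m (U i) x @[i --> F] --> mgrad_norm m u x.
Proof.
rewrite mgrad_normE; under eq_fun do rewrite mgrad_normE.
exact: (cvg_comp _ _ (mform_cvg m U U u u x Uu Uu) (@sqrt_continuous R _)).
Qed.

Lemma energy_cvg m l h : 1 < l ->
  energy m l h (U i) @[i --> F] --> energy m l h u.
Proof.
move=> l1; have l0 : 0 < l by lra.
apply: cvgM; first exact: cvg_cst.
apply: vint_cvg => x; apply: cvgD.
  by apply: cvg_powR => //; [move=> i| |exact: mgrad_norm_cvg]; exact: mgrad_norm_ge0.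
apply: cvgM; first exact: cvg_cst.
by apply: cvg_powR => //; exact: cvg_norm.
Qed.

Lemma Lop_cvg m l x : 1 < l -> Lop m l (U i) x @[i --> F] --> Lop m l u x.
Proof.
move=> l1; rewrite LopE; under eq_fun do rewrite LopE weak_formE.
rewrite weak_formE; apply: cvgM; first exact: cvg_cst.
apply: vint_cvg => y.
apply: (@cvg_duality _ _ _ _ _ _ _ _ (mgrad_norm m (delta x) y)) => //.
- by move=> i; exact: mgrad_norm_ge0.
- exact: mgrad_norm_ge0.
- by move=> i; rewrite !mgrad_normE; exact: mform_CauchySchwarz.
- by rewrite !mgrad_normE; exact: mform_CauchySchwarz.
- exact: mgrad_norm_cvg.
- by apply: mform_cvg => [//|z]; exact: cvg_cst.
Qed.

Lemma energy_grad_cvg m l h x : 1 < l ->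
  energy_grad m l h (U i) x @[i --> F] --> energy_grad m l h u x.
Proof.
move=> l1; apply: cvgD; first exact: Lop_cvg.
apply: cvgM; first exact: cvg_cst.
apply: (@cvg_duality _ _ _ _ _ _ _ _ 1) => //; rewrite ?mul1r//.
- by move=> i; rewrite mul1r.
- exact: cvg_norm.
Qed.

End Continuity.

End Energy.

(** * The functional of the system *)

Lemma powR_dominated {R : realType} (a b alpha p : R) :
  0 < a -> 0 <= alpha < p ->
  exists C, forall s, 0 <= s -> b * s `^ alpha <= a * s `^ p + C.
Proof.
move=> a0 /andP[al0 alp]; have p0 : 0 < p by lra.
(* [M] is where [a * s `^ (p - alpha)] passes [`|b|]. *)
pose M := (`|b| / a) `^ (p - alpha)^-1.
have pa : 0 < p - alpha by lra.
exists (`|b| * M `^ alpha) => s s0.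
have bs : b * s `^ alpha <= `|b| * s `^ alpha.
  by apply: ler_wpM2r; [exact: powR_ge0 | exact: ler_norm].
have [sM|Ms] := leP s M.
  have : s `^ alpha <= M `^ alpha by rewrite ge0_ler_powR ?nnegrE ?powR_ge0.
  move=> /(ler_wpM2l (normr_ge0 b)); have := mulr_ge0 (ltW a0) (powR_ge0 s p); lra.
have s_gt0 : 0 < s by apply: le_lt_trans Ms; exact: powR_ge0.
have Mpa : M `^ (p - alpha) = `|b| / a.
  by rewrite -powRrM mulVf ?lt0r_neq0// powRr1// divr_ge0// ltW.
have : M `^ (p - alpha) <= s `^ (p - alpha).
  by rewrite ge0_ler_powR ?nnegrE ?powR_ge0 ?(ltW Ms) ?(ltW pa).
rewrite Mpa ler_pdivrMr// => bsa.
have sp : s `^ p = s `^ (p - alpha) * s `^ alpha.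
  by rewrite -powRD ?subrK// (lt0r_neq0 s_gt0) implybT.
have := ler_wpM2r (powR_ge0 s alpha) bsa.
have := mulr_ge0 (normr_ge0 b) (powR_ge0 M alpha).
rewrite sp; lra.
Qed.

Section Functional.
Context {R : realType} {G : weighted_graph R}.
Variables (m1 m2 : nat) (p q : R) (h1 h2 : G -> R) (F : G -> R -> R -> R).
Variable lambda : R.

(** The pair [(u, v)] is the single function [z] with [z (true, x) = u x] and
[z (false, x) = v x], so that the space of pairs is a power of [R]. *)
Let T : topologicalType := {ptws (bool * G)%type -> R}.

Definition pot (z : T) : R :=
  energy m1 p h1 (fun x => z (true, x)) + energy m2 q h2 (fun x => z (false, x)).

Definition action (z : T) : R :=
  pot z - lambda * vint (fun x => F x (z (true, x)) (z (false, x))).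

(** Minus the gradient of [action] in the inner product weighted by the measure,
that is, minus the residual of the system. *)
Definition descent (z : T) : T := fun i =>
  let u := fun x => z (true, x) in let v := fun x => z (false, x) in
  if i.1 then lambda * partial1 (F i.2) (u i.2) (v i.2) - energy_grad m1 p h1 u i.2
  else lambda * partial2 (F i.2) (u i.2) (v i.2) - energy_grad m2 q h2 v i.2.

Definition step (t : R) (z : T) : T := fun i => z i + t * descent z i.

Definition critical (z : T) : Prop := forall i, descent z i = 0.

Lemma critical_solution z : critical z -> system_solution p q h1 h2 F m1 m2 lambda
  (fun x => z (true, x), fun x => z (false, x)).
Proof.
move=> cz x; have := cz (true, x); have := cz (false, x).
by rewrite /descent /energy_grad /=; split; lra.
Qed.

Hypotheses (p_gt1 : 1 < p) (q_gt1 : 1 < q).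
Hypothesis h_gt0 : forall x, 0 < h1 x /\ 0 < h2 x.
Hypothesis F_C1 : forall x, cont_diff2 (F x).

Section Convergence.
Context {X : Type} (Fi : set_system X) {FF : Filter Fi}.
Variables (Z : X -> T) (z : T).
Hypothesis Zz : forall i, Z j i @[j --> Fi] --> z i.

Lemma pot_cvg : pot (Z j) @[j --> Fi] --> pot z.
Proof. by apply: cvgD; apply: energy_cvg => // x; exact: Zz. Qed.

Lemma action_cvg : action (Z j) @[j --> Fi] --> action z.
Proof.
apply: cvgB; first exact: pot_cvg.
apply: cvgM; first exact: cvg_cst.
by apply: vint_cvg => x; apply: cont_diff2_cvg => //; exact: Zz.
Qed.

Lemma descent_cvg i : descent (Z j) i @[j --> Fi] --> descent z i.
Proof.
case: i => -[] x; rewrite /descent /=; apply: cvgB.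
- apply: cvgM; first exact: cvg_cst.
  have [_ _ c1 _] := F_C1 x.
  exact: (cvg_cont2 _ _ _ _ _ _ c1 (Zz (true, x)) (Zz (false, x))).
- by apply: energy_grad_cvg => // y; exact: Zz.
- apply: cvgM; first exact: cvg_cst.
  have [_ _ _ c2] := F_C1 x.
  exact: (cvg_cont2 _ _ _ _ _ _ c2 (Zz (true, x)) (Zz (false, x))).
- by apply: energy_grad_cvg => // y; exact: Zz.
Qed.

Lemma step_cvg (tau : X -> R) (t : R) : tau @ Fi --> t ->
  step (tau j) (Z j) @[j --> Fi] --> step t z.
Proof.
move=> tt; apply: cvg_ptws => i; apply: cvgD; first exact: Zz.
by apply: cvgM => //; exact: descent_cvg.
Qed.

End Convergence.

Lemma coord_cvg (z : T) i : y i @[y --> z] --> z i.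
Proof. exact: (ptws_coord_cvg (nbhs z) id z i cvg_id). Qed.

Lemma pot_continuous : continuous pot.
Proof. by move=> z; exact: (pot_cvg (nbhs z) id z (coord_cvg z)). Qed.

Lemma action_continuous : continuous action.
Proof. by move=> z; exact: (action_cvg (nbhs z) id z (coord_cvg z)). Qed.

Lemma step_continuous t : continuous (step t).
Proof.
move=> z; exact: (step_cvg (nbhs z) id z (coord_cvg z) (fun=> t) t (cvg_cst t)).
Qed.

Lemma step_critical t z : critical z -> step t z = z.
Proof. by move=> cz; apply/funext => i; rewrite /step cz mulr0 addr0. Qed.

Lemma step0 z : step 0 z = z.
Proof. by apply/funext => i; rewrite /step mul0r addr0. Qed.

Section Near.
Variable z : T.
Let near_z : set_system (T * R) := filter_prod (nbhs z) 0^'+.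

#[local] Instance near_z_filter : Filter near_z.
Proof. exact: filter_prod_filter. Qed.

Lemma near_coord_cvg i : yt.1 i @[yt --> near_z] --> z i.
Proof. exact: (cvg_comp _ _ cvg_fst (coord_cvg z i)). Qed.

Lemma near_time_cvg : yt.2 @[yt --> near_z] --> (0 : R).
Proof.
apply: (cvg_trans (cvg_snd : snd @ near_z --> 0^'+)).
exact: (@cvg_within _ (nbhs (0 : R))).
Qed.

Lemma step_near : (fun yt : T * R => step yt.2 yt.1) @ near_z --> z.
Proof.
have := step_cvg near_z fst z near_coord_cvg snd 0 near_time_cvg.
by rewrite step0; apply.
Qed.

(** The decrease of [action] over a step is at least [- t * B (y, t)]: the gradient
inequality bounds the increment of [pot] through the gradient at the end of the
step, and the increment of the nonlinear term is [t] times its difference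
quotient. As [t] tends to [0] and [y] to [z], the limit of [B] is minus the squared
norm [N] of the gradient at [z], whence the rate [N / 2]. *)
Lemma step_descent : ~ critical z -> exists2 e : R, 0 < e &
  \forall y \near z & t \near 0^'+, action (step t y) <= action y - t * e.
Proof.
move=> ncz.
pose sqnorm (d : T) :=
  vint (fun x => d (true, x) ^+ 2) + vint (fun x => d (false, x) ^+ 2).
pose N := sqnorm (descent z).
have sq_ge0 (b : bool) : 0 <= vint (fun x => descent z (b, x) ^+ 2).
  by apply: vint_ge0 => x; exact: sqr_ge0.
have N_gt0 : 0 < N.
  rewrite lt_neqAle addr_ge0 ?andbT//; apply/eqP => N0.
  have := N0; rewrite /N /sqnorm => sum0; apply: ncz => -[b x].
  have sq0 : vint (fun x => descent z (b, x) ^+ 2) = 0.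
    by have := sq_ge0 true; have := sq_ge0 false; case: b; lra.
  have := vint_eq0 (fun x => descent z (b, x) ^+ 2) (fun x => sqr_ge0 _) sq0 x.
  by move=> /eqP; rewrite sqrf_eq0 => /eqP.
pose S (yt : T * R) : T := step yt.2 yt.1.
pose B (yt : T * R) : R :=
  vint (fun x => energy_grad m1 p h1 (fun x => S yt (true, x)) x *
                 descent yt.1 (true, x)) +
  vint (fun x => energy_grad m2 q h2 (fun x => S yt (false, x)) x *
                 descent yt.1 (false, x)) -
  lambda * vint (fun x => (F x (S yt (true, x)) (S yt (false, x)) -
                           F x (yt.1 (true, x)) (yt.1 (false, x))) / yt.2).
have time_gt0 : \forall yt \near near_z, 0 < yt.2.
  exists (setT, [set t : R | 0 < t]); last by move=> [y t] [].
  by split => /=; [exact: filterT | exact: nbhs_right_gt].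
have S_cvg i : S yt i @[yt --> near_z] --> z i.
  exact: (ptws_coord_cvg near_z S z i step_near).
have D_cvg i : descent yt.1 i @[yt --> near_z] --> descent z i.
  exact: (descent_cvg near_z fst z near_coord_cvg).
have B_cvg : B @ near_z --> - N.
  rewrite (_ : - N =
    vint (fun x => energy_grad m1 p h1 (fun x => z (true, x)) x *
                   descent z (true, x)) +
    vint (fun x => energy_grad m2 q h2 (fun x => z (false, x)) x *
                   descent z (false, x)) -
    lambda * vint (fun x =>
      partial1 (F x) (z (true, x)) (z (false, x)) * descent z (true, x) +
      partial2 (F x) (z (true, x)) (z (false, x)) * descent z (false, x))); last first.
    rewrite /N /sqnorm -!vintD -vintZ -mulN1r -[in RHS]mulN1r -!vintZ -vintD.
    by congr vint; apply/funext => x; rewrite /descent /=; ring.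
  apply: cvgB.
    by apply: cvgD; apply: vint_cvg => x; apply: cvgM => //;
      apply: energy_grad_cvg => // y; exact: S_cvg.
  apply: cvgM; first exact: cvg_cst.
  apply: vint_cvg => x; apply: cont_diff2_quotient => //.
  - exact: near_coord_cvg.
  - exact: near_coord_cvg.
  - exact: near_time_cvg.
  - by apply: filterS time_gt0 => yt /lt0r_neq0.
have B_near : \forall yt \near near_z, B yt < - (N / 2).
  by apply: (B_cvg [set b | b < - (N / 2)]); apply: lt_nbhsl; lra.
exists (N / 2); first lra.
apply: filterS2 B_near time_gt0 => -[y t] /= B_lt t0.
suff : action (step t y) - action y <= t * B (y, t).
  by have := ltr_pM2l t0 (B (y, t)) (- (N / 2)); rewrite B_lt; lra.
have e1 := energy_subgradient m1 p h1 (fun x => y (true, x))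
  (fun x => step t y (true, x)) p_gt1 (fun x => (h_gt0 x).1).
have e2 := energy_subgradient m2 q h2 (fun x => y (false, x))
  (fun x => step t y (false, x)) q_gt1 (fun x => (h_gt0 x).2).
have v1 m l h b : vint (fun x => energy_grad m l h (fun x => step t y (b, x)) x *
    (y (b, x) - step t y (b, x))) =
    - t * vint (fun x => energy_grad m l h (fun x => step t y (b, x)) x *
                         descent y (b, x)).
  by rewrite -vintZ; congr vint; apply/funext => x; rewrite /step; ring.
rewrite !v1 in e1 e2.
have vF : t * vint (fun x => (F x (step t y (true, x)) (step t y (false, x)) -
      F x (y (true, x)) (y (false, x))) / t) =
    vint (fun x => F x (step t y (true, x)) (step t y (false, x))) -
    vint (fun x => F x (y (true, x)) (y (false, x))).
  rewrite -vintZ -[X in _ = _ + X]mulN1r -[X in _ = _ + X]vintZ -vintD; congr vint.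
  by apply/funext => x; field; rewrite gt_eqF.
rewrite /B /S /action /pot /= mulrBr [t * (lambda * _)]mulrCA vF.
lra.
Qed.

End Near.

(** Half of [pot] absorbs the growth of [F], whose exponents are smaller; the other
half bounds every coordinate. *)
Lemma action_compact (alpha beta : R) (f1 f2 g : G -> R) :
  0 <= lambda -> 0 <= alpha < p -> 0 <= beta < q ->
  (forall x s t, F x s t <= f1 x * `|s| `^ alpha + f2 x * `|t| `^ beta + g x) ->
  forall s, compact [set z : T | action z <= s].
Proof.
move=> lambda0 al be Fle s0.
have p0 : 0 < p by lra.
have q0 : 0 < q by lra.
have a1 x : 0 < h1 x / (2 * p) by rewrite divr_gt0 ?mulr_gt0 ?(h_gt0 x).1; lra.
have a2 x : 0 < h2 x / (2 * q) by rewrite divr_gt0 ?mulr_gt0 ?(h_gt0 x).2; lra.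
have /choice[C1 C1P] := fun x => powR_dominated _ (lambda * f1 x) _ _ (a1 x) al.
have /choice[C2 C2P] := fun x => powR_dominated _ (lambda * f2 x) _ _ (a2 x) be.
pose K := vint (fun x => C1 x + C2 x + lambda * g x).
have bound z : vint (fun x => h1 x / (2 * p) * `|z (true, x)| `^ p +
    h2 x / (2 * q) * `|z (false, x)| `^ q) <= action z + K.
  have e1 := energy_ge m1 p h1 (fun x => z (true, x)) p_gt1.
  have e2 := energy_ge m2 q h2 (fun x => z (false, x)) q_gt1.
  suff : vint (fun x => h1 x / (2 * p) * `|z (true, x)| `^ p +
      h2 x / (2 * q) * `|z (false, x)| `^ q) +
      lambda * vint (fun x => F x (z (true, x)) (z (false, x))) <=
      p^-1 * vint (fun x => h1 x * `|z (true, x)| `^ p) +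
      q^-1 * vint (fun x => h2 x * `|z (false, x)| `^ q) + K.
    by rewrite /action /pot; lra.
  rewrite -!vintZ -!vintD; apply: vint_le => x.
  have := ler_wpM2l lambda0 (Fle x (z (true, x)) (z (false, x))).
  have := C1P x _ (normr_ge0 (z (true, x))).
  have := C2P x _ (normr_ge0 (z (false, x))).
  have -> : h1 x / (2 * p) * `|z (true, x)| `^ p =
    2^-1 * (p^-1 * (h1 x * `|z (true, x)| `^ p)) by field; lra.
  have -> : h2 x / (2 * q) * `|z (false, x)| `^ q =
    2^-1 * (q^-1 * (h2 x * `|z (false, x)| `^ q)) by field; lra.
  lra.
pose A (i : bool * G) := if i.1 then vmeas i.2 * (h1 i.2 / (2 * p))
  else vmeas i.2 * (h2 i.2 / (2 * q)).
pose l (i : bool * G) := if i.1 then p else q.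
have A0 i : 0 < A i by rewrite /A; case: ifP => _; rewrite mulr_gt0 ?vmeas_gt0.
have l0 i : 0 < l i by rewrite /l; case: ifP.
pose M i := ((s0 + K) / A i) `^ (l i)^-1.
have box : compact [set z : T | forall i, [set` `[- M i, M i]] (z i)].
  exact: (@tychonoff _ (fun=> R : topologicalType) _
    (fun i => @segment_compact R (- M i) (M i))).
apply: (subclosed_compact _ box).
  exact: (@preimage_closed _ _ action _ (in1W action_continuous) (@closed_le R s0)).
move=> z /= zs i; rewrite in_itv /= -ler_norml.
have Ai : `|z i| `^ l i <= (s0 + K) / A i.
  rewrite ler_pdivlMr// mulrC; apply: le_trans (le_trans (bound z) _); last first.
    by rewrite lerD2r.
  apply: le_trans (vint_ge_term _ i.2 _); last first.
    by move=> y; rewrite addr_ge0// mulr_ge0 ?powR_ge0 ?ltW.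
  rewrite mulrDr !mulrA; case: i => -[] x; rewrite /A /l /= !mulrA.
    rewrite lerDl !mulr_ge0 ?powR_ge0 ?invr_ge0 ?ltW ?vmeas_gt0 ?(h_gt0 x).2//.
    by rewrite mulr_gt0.
  rewrite lerDr !mulr_ge0 ?powR_ge0 ?invr_ge0 ?ltW ?vmeas_gt0 ?(h_gt0 x).1//.
  by rewrite mulr_gt0.
rewrite -[leLHS](powRr1 (normr_ge0 _)) -(mulfV (lt0r_neq0 (l0 i))) powRrM.
apply: ge0_ler_powR => //; rewrite ?nnegrE ?invr_ge0 ?powR_ge0 ?(ltW (l0 i))//.
exact: le_trans (powR_ge0 _ _) Ai.
Qed.

End Functional.

(** * Constants of the theorem *)

Section Constants.
Context {R : realType} {G : weighted_graph R}.
Implicit Types (h : G -> R).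

Lemma vmin_le h x : vmin h <= h x.
Proof.
apply: ge_inf; last by exists x.
exists (- \sum_(y : G) `|h y|) => _ [y _ <-].
rewrite lerNl (le_trans (ler_norm _))// normrN (bigD1 y) //= lerDl.
exact: sumr_ge0.
Qed.

Lemma vmin_gt0 h (x0 : G) : (forall x, 0 < h x) -> 0 < vmin h.
Proof.
move=> h0.
have [x _ xmin] := @Order.TotalTheory.arg_minP _ _ G x0 predT h isT.
apply: lt_le_trans (h0 x) _; apply: lb_le_inf; first by exists (h x0), x0.
by move=> _ [y _ <-]; exact: xmin.
Qed.

(** The [h]-term at a single vertex is at most the whole energy. *)
Lemma energy_radius (m : nat) (l r : R) h u x : 1 < l -> (forall x, 0 < h x) ->
  energy m l h u <= r ->
  `|u x| <= (l * r) `^ l^-1 / (vmin h `^ l^-1 * vmin (@vmeas R G) `^ l^-1).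
Proof.
move=> l1 h0 ur; have l0 : 0 < l by lra.
have hm := vmin_gt0 h x h0.
have mm := vmin_gt0 _ x (@vmeas_gt0 R G).
have le_lr : vmeas x * (h x * `|u x| `^ l) <= l * r.
  have := vint_ge_term (fun x => h x * `|u x| `^ l) x.
  move=> /(_ (fun y => mulr_ge0 (ltW (h0 y)) (powR_ge0 _ _))) /le_trans; apply.
  rewrite -[leLHS](mulKf (lt0r_neq0 l0)) mulrCA ler_pM2l//.
  exact: le_trans (energy_ge m l h u l1) ur.
rewrite ler_pdivlMr ?mulr_gt0 ?powR_gt0//.
rewrite -[X in X * _ <= _](powRr1 (normr_ge0 _)) -{1}(mulfV (lt0r_neq0 l0)) powRrM.
rewrite -!powRM ?mulr_ge0 ?powR_ge0 ?(ltW hm) ?(ltW mm)//.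
have le_abs : `|u x| `^ l * (vmin h * vmin (@vmeas R G)) <= l * r.
  apply: le_trans le_lr; rewrite mulrC -mulrA mulrCA.
  apply: ler_pM; rewrite ?mulr_ge0 ?powR_ge0 ?(ltW hm) ?(ltW mm)//.
    exact: vmin_le.
  by apply: ler_wpM2r; [exact: powR_ge0 | exact: vmin_le].
apply: ge0_ler_powR => //; rewrite ?nnegrE ?invr_ge0 ?(ltW l0)//.
  by rewrite mulr_ge0 ?powR_ge0// mulr_ge0// ltW.
by apply: le_trans le_abs; rewrite mulr_ge0 ?powR_ge0// mulr_ge0// ltW.
Qed.

(** By [energy_cst] the right-hand side is the energy of the constant function
[delta], so the constant pair lies beyond the barrier. *)
Lemma gamma_lt_energy (l gamma delta : R) h : 1 < l -> 0 < gamma -> 0 < delta ->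
  0 < vint h -> gamma * kappa l h < delta ->
  gamma `^ l < delta `^ l / l * vint h.
Proof.
move=> l1 g0 d0 H0 gd; have l0 : 0 < l by lra.
have k0 : 0 <= gamma * kappa l h by rewrite mulr_ge0 ?powR_ge0 ?ltW.
have := gt0_ltr_powR l0 k0 (ltW d0) gd.
rewrite powRM ?powR_ge0 ?(ltW g0)// /kappa -powRrM mulNr mulVf ?lt0r_neq0//.
rewrite powR_inv1; last by rewrite mulr_ge0 ?invr_ge0 ?ltW.
rewrite ltr_pdivrMr ?mulr_gt0 ?invr_gt0//.
by rewrite mulrA.
Qed.

End Constants.

(** * The three solutions *)

(* The interval for lambda is taken in the extended reals, where 0^-1 = +oo;
   this matters when Lambda1 = 0. *)
Theorem theorem1p1 (R : realType) (G : weighted_graph R) (m1 m2 : nat)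
    (p q : R) (h1 h2 : G -> R) (F : G -> R -> R -> R)
    (gamma1 gamma2 delta1 delta2 lambda : R)
    (m1_ge1 : (1 <= m1)%N) (m2_ge1 : (1 <= m2)%N)
    (p_gt1 : 1 < p) (q_gt1 : 1 < q)
    (H : forall x : G, 0 < h1 x /\ 0 < h2 x)
    (F0 : forall x : G, cont_diff2 (F x))
    (F1 : vint (fun x => F x 0 0) = 0)
    (F2 : exists (alpha beta : R) (f1 f2 g : G -> R),
        [/\ 0 <= alpha < p, 0 <= beta < q &
            forall (x : G) (s t : R),
              F x s t <= f1 x * `|s| `^ alpha + f2 x * `|t| `^ beta + g x])
    (gamma1_gt0 : 0 < gamma1) (gamma2_gt0 : 0 < gamma2)
    (delta1_gt0 : 0 < delta1) (delta2_gt0 : 0 < delta2)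
    (delta1_gt : gamma1 * kappa p h1 < delta1)
    (delta2_gt : gamma2 * kappa q h2 < delta2)
    (F3 : Lambda1 p q h1 h2 F gamma1 gamma2
            < Lambda2 p q h1 h2 F delta1 delta2)
    (lambda_gt : (((Lambda2 p q h1 h2 F delta1 delta2)%:E)^-1 < lambda%:E)%E)
    (lambda_lt : (lambda%:E < ((Lambda1 p q h1 h2 F gamma1 gamma2)%:E)^-1)%E) :
  exists z1 z2 z3 : (G -> R) * (G -> R),
    [/\ system_solution p q h1 h2 F m1 m2 lambda z1,
        system_solution p q h1 h2 F m1 m2 lambda z2 &
        system_solution p q h1 h2 F m1 m2 lambda z3] /\
    [/\ z1 <> z2, z1 <> z3 & z2 <> z3].
Proof.
have p0 : 0 < p by lra.
have q0 : 0 < q by lra.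
have [alpha [beta [f1 [f2 [g [al be Fle]]]]]] := F2.
(* Without vertices [Lambda1] and [Lambda2] are both [0]. *)
have [[x0 _]|no_vertex] := pselect (exists x0 : G, True); last first.
  have vol0 : vol G = 0.
    by rewrite /vol big1 // => x; case: no_vertex; exists x.
  by move: F3; rewrite /Lambda1 /Lambda2 vol0 !mulr0 mul0r ltxx.
have vol_cst c : vint (fun _ : G => c) = c * vol G.
  by rewrite /vint /vol big_distrr; apply: eq_bigr => x _; rewrite mulrC.
have vint_h_gt0 (h : G -> R) : (forall x, 0 < h x) -> 0 < vint h.
  move=> h0; apply: lt_le_trans (vint_ge_term h x0 (fun x => ltW (h0 x))).
  by rewrite mulr_gt0// vmeas_gt0.
pose r := gamma1 `^ p + gamma2 `^ q.
have r_gt0 : 0 < r by rewrite addr_gt0// powR_gt0.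
pose M1 := radius1 p q h1 gamma1 gamma2.
pose M2 := radius2 p q h2 gamma1 gamma2.
pose S := sup [set c | exists (x : G) (s t : R),
  [/\ `|s| <= M1, `|t| <= M2 & c = F x s t]].
have M1_ge0 : 0 <= M1.
  by rewrite /M1 /radius1 divr_ge0 ?mulr_ge0 ?powR_ge0.
have M2_ge0 : 0 <= M2.
  by rewrite /M2 /radius2 divr_ge0 ?mulr_ge0 ?powR_ge0.
have F_le_S x s t : `|s| <= M1 -> `|t| <= M2 -> F x s t <= S.
  move=> sM tM; apply: sup_upper_bound; last by exists x, s, t.
  split; first by exists (F x s t), x, s, t.
  exists (\sum_(y : G) (`|f1 y| * M1 `^ alpha + `|f2 y| * M2 `^ beta + `|g y|)).
  move=> _ [y [s' [t' [sM' tM' ->]]]]; apply: le_trans (Fle y s' t') _.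
  rewrite (bigD1 y) //= -[leLHS]addr0; apply: lerD; last first.
    by apply: sumr_ge0 => i _; rewrite !addr_ge0 ?mulr_ge0 ?powR_ge0.
  apply: lerD; last exact: ler_norm.
  have pow_le (c c' M e : R) : 0 <= e -> `|c'| <= M ->
      c * `|c'| `^ e <= `|c| * M `^ e.
    move=> e0 cM; apply: le_trans (ler_wpM2r (powR_ge0 _ _) (ler_norm c)) _.
    apply: ler_wpM2l => //; apply: ge0_ler_powR => //; rewrite ?nnegrE//.
    exact: le_trans cM.
  by case/andP: al => al0 _; case/andP: be => be0 _; apply: lerD; exact: pow_le.
have vint_F_le_S (u v : G -> R) : (forall x, `|u x| <= M1) ->
    (forall x, `|v x| <= M2) -> vint (fun x => F x (u x) (v x)) <= S * vol G.
  by move=> uM vM; rewrite -vol_cst; apply: vint_le => x; exact: F_le_S.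
have Lambda1E : Lambda1 p q h1 h2 F gamma1 gamma2 * r = S * vol G.
  by rewrite /Lambda1 -/r -/M1 -/M2 -/S; field; rewrite gt_eqF.
set L1 := Lambda1 _ _ _ _ _ _ _ in F3 lambda_lt Lambda1E.
(* The rectangle contains the origin, where the integral of [F] vanishes. *)
have L1_ge0 : 0 <= L1.
  rewrite -(pmulr_lge0 _ r_gt0) Lambda1E -F1.
  by apply: vint_F_le_S => x; rewrite normr0.
set L2 := Lambda2 _ _ _ _ _ _ _ in F3 lambda_gt.
have L2_gt0 : 0 < L2 by lra.
have lambda_L2 : 1 < lambda * L2.
  move: lambda_gt; rewrite inver gt_eqF// lte_fin => h.
  by rewrite -ltr_pdivrMr// div1r.
have lambda_gt0 : 0 < lambda.
  by rewrite -(pmulr_lgt0 _ L2_gt0); lra.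
have lambda_L1 : lambda * L1 < 1.
  have := L1_ge0; rewrite le_eqVlt => /predU1P[<-|L1_gt0].
    by rewrite mulr0 ltr01.
  move: lambda_lt; rewrite inver gt_eqF// lte_fin => h.
  by rewrite -ltr_pdivlMr// div1r.
pose J := action m1 m2 p q h1 h2 F lambda.
pose Phi := pot m1 m2 p q h1 h2.
pose rho := r * (1 - lambda * L1).
have rho_gt0 : 0 < rho by rewrite mulr_gt0// subr_gt0.
have sep z : Phi z = r -> rho <= J z.
  move=> zr.
  have h1_gt0 x : 0 < h1 x := (H x).1.
  have h2_gt0 x : 0 < h2 x := (H x).2.
  have e_ge0 m l (h u : G -> R) :
      1 < l -> (forall x, 0 < h x) -> 0 <= energy m l h u.
    move=> l1 h0; apply: le_trans (energy_ge m l h u l1).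
    rewrite mulr_ge0 ?invr_ge0 ?vint_ge0//; first by lra.
    by move=> x; rewrite mulr_ge0 ?powR_ge0 ?ltW.
  have e1 := e_ge0 m1 p h1 (fun x => z (true, x)) p_gt1 h1_gt0.
  have e2 := e_ge0 m2 q h2 (fun x => z (false, x)) q_gt1 h2_gt0.
  have uM x : `|z (true, x)| <= M1.
    rewrite /M1 /radius1 -mulrDr -/r.
    apply: (energy_radius m1 p r h1 (fun x => z (true, x))) => //.
    by rewrite -zr /Phi /pot lerDl.
  have vM x : `|z (false, x)| <= M2.
    rewrite /M2 /radius2 -mulrDr -/r.
    apply: (energy_radius m2 q r h2 (fun x => z (false, x))) => //.
    by rewrite -zr /Phi /pot lerDr.
  have := ler_wpM2l (ltW lambda_gt0) (vint_F_le_S _ _ uM vM).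
  by rewrite -Lambda1E /J /action -/(Phi z) zr /rho; lra.
pose w : {ptws (bool * G)%type -> R} := fun i => if i.1 then delta1 else delta2.
pose D := delta1 `^ p / p * vint h1 + delta2 `^ q / q * vint h2.
have Phi_w : Phi w = D.
  rewrite /Phi /pot /w /= !energy_cst//.
  by rewrite !ger0_norm// ltW.
have D_gt : r < D.
  apply: ltrD; apply: gamma_lt_energy => //; apply: vint_h_gt0 => x.
    exact: (H x).1.
  exact: (H x).2.
have Jw : J w <= 0.
  rewrite /J /action -/(Phi w) Phi_w /w /=.
  have L2D : L2 * D = vmin (fun x => F x delta1 delta2) * vol G.
    by rewrite /L2 /Lambda2 -/D divfK// gt_eqF//; lra.
  have := vint_le _ _ (fun x => vmin_le (fun x => F x delta1 delta2) x).
  rewrite vol_cst -L2D => /(ler_wpM2l (ltW lambda_gt0)).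
  have D_lt : D < lambda * L2 * D by rewrite ltr_pMl//; lra.
  lra.
pose a : {ptws (bool * G)%type -> R} := fun=> 0.
have Phi_a : Phi a = 0.
  by rewrite /Phi /pot /a /= !energy_cst// normr0 !powR0 ?gt_eqF// !mul0r addr0.
have Ja : J a <= 0.
  by rewrite /J /action -/(Phi a) Phi_a /a /= F1 mulr0 subr0.
have [z1 [z2 [z3 [[c1 c2 c3] [n12 n13 n23]]]]] :=
  three_critical_points J (critical m1 m2 p q h1 h2 F lambda)
    (step m1 m2 p q h1 h2 F lambda)
    (action_continuous m1 m2 p q h1 h2 F lambda p_gt1 q_gt1 F0)
    (action_compact m1 m2 p q h1 h2 F lambda p_gt1 q_gt1 H F0
       alpha beta f1 f2 g (ltW lambda_gt0) al be Fle)
    (step_critical m1 m2 p q h1 h2 F lambda)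
    (step_continuous m1 m2 p q h1 h2 F lambda p_gt1 q_gt1 F0)
    (step_near m1 m2 p q h1 h2 F lambda p_gt1 q_gt1 F0)
    (step_descent m1 m2 p q h1 h2 F lambda p_gt1 q_gt1 H F0)
    Phi r rho a w
    (pot_continuous m1 m2 p q h1 h2 p_gt1 q_gt1)
    rho_gt0 (ptws_path _) sep
    (eq_ind_r (fun c => c < r) r_gt0 Phi_a) Ja
    (eq_ind_r (fun c => r < c) D_gt Phi_w) Jw.
pose pair (z : {ptws (bool * G)%type -> R}) : (G -> R) * (G -> R) :=
  (fun x => z (true, x), fun x => z (false, x)).
have pair_inj : injective pair.
  move=> y z /= [yz1 yz2]; apply/funext => -[[] x].
    by have := congr1 (fun f => f x) yz1.
  by have := congr1 (fun f => f x) yz2.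
exists (pair z1), (pair z2), (pair z3); split.
  by split; exact: critical_solution.
by split => /pair_inj.
Qed.
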